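(* Let $\mathcal{X}$ be a class of nonabelian CSA groups (hence $\mathcal{X}$ satisfies $B\mathcal{X}$). Let $\mathcal{Y}$ be the class of groups which are free products $G_1 \star G_2$ of groups $G_1, G_2$ from $\mathcal{X}$. Then $\mathcal{Y}$ satisfies $B\mathcal{Y}$.
   Context: Let $\mathcal{X}$ be a class of groups. A group $G$ is residually $\mathcal{X}$ if for every nontrivial $g \in G$ there is a homomorphism $\phi: G \to H$ with $H \in \mathcal{X}$ and $\phi(g) \neq 1$. $G$ is fully residually $\mathcal{X}$ if for every finite set of nontrivial elements $g_1,\dots,g_n \in G$ there is a homomorphism $\phi: G \to H$ with $H \in \mathcal{X}$ and $\phi(g_i) \neq 1$ for all $i$. A group $G$ is commutative transitive (CT) if for all nontrivial $x,y,z \in G$, $[x,y]=1$ and $[y,z]=1$ imply $[x,z]=1$. A subgroup $M \le G$ is malnormal if $g^{-1}Mg \cap M \neq \{1\}$ implies $g \in M$. A group is CSA if all its maximal abelian subgroups are malnormal. A class $\mathcal{X}$ satisfies $B\mathcal{X}$ if every nonabelian group $G$ is fully residually $\mathcal{X}$ if and only if $G$ is residually $\mathcal{X}$ and CT. *)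

(* Defs.v *)
From HB Require Import structures.
From mathcomp Require Import all_boot.
From mathcomp Require Import all_classical.

Set Implicit Arguments.
Unset Strict Implicit.
Unset Printing Implicit Defensive.

Local Open Scope classical_set_scope.
Local Open Scope group_scope.

(* Groups are arbitrary (possibly infinite): [groupType] from monoid.v.       *)
(* A multiplicative map between groups is a group homomorphism, so            *)
(* homomorphisms are [{multiplicative G -> H}].                               *)
Definition group_class := groupType -> Prop.

Section Subgroups.
Variable G : groupType.
Implicit Types M N : set G.

Definition is_subgroup M : Prop :=
  [/\ M 1, (forall x y, M x -> M y -> M (x * y)) & (forall x, M x -> M x^-1)].

Definition abelian_set M : Prop := forall x y, M x -> M y -> commute x y.

Definition is_abelian_subgroup M : Prop := is_subgroup M /\ abelian_set M.

Definition is_maximal_abelian M : Prop :=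
  is_abelian_subgroup M /\
  forall N, is_abelian_subgroup N -> M `<=` N -> N = M.

(* [m ^ g] is the conjugate g^-1 * m * g.                                     *)
Definition is_malnormal M : Prop :=
  forall g : G, [set m ^ g | m in M] `&` M <> [set 1] -> M g.

End Subgroups.

Definition nonabelian (G : groupType) : Prop := ~ abelian_set [set: G].

Definition commutative_transitive (G : groupType) : Prop :=
  forall x y z : G, x <> 1 -> y <> 1 -> z <> 1 ->
    [~ x, y] = 1 -> [~ y, z] = 1 -> [~ x, z] = 1.

Definition CSA (G : groupType) : Prop :=
  forall M : set G, is_maximal_abelian M -> is_malnormal M.

Definition residually (X : group_class) (G : groupType) : Prop :=
  forall g : G, g <> 1 ->
    exists (H : groupType) (phi : {multiplicative G -> H}),
      X H /\ phi g <> 1.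

Definition fully_residually (X : group_class) (G : groupType) : Prop :=
  forall s : seq G, (forall g, g \in s -> g <> 1) ->
    exists (H : groupType) (phi : {multiplicative G -> H}),
      X H /\ forall g, g \in s -> phi g <> 1.

Definition satisfies_B (X : group_class) : Prop :=
  forall G : groupType, nonabelian G ->
    (fully_residually X G <-> residually X G /\ commutative_transitive G).

(* The free product is the coproduct in the category of groups, determined   *)
(* up to isomorphism by its universal property.                               *)
Definition is_free_product (G1 G2 G : groupType)
    (i1 : {multiplicative G1 -> G}) (i2 : {multiplicative G2 -> G}) : Prop :=
  forall (H : groupType)
         (f1 : {multiplicative G1 -> H}) (f2 : {multiplicative G2 -> H}),
    exists f : {multiplicative G -> H},
      [/\ f \o i1 =1 f1, f \o i2 =1 f2
        & forall f' : {multiplicative G -> H},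
            f' \o i1 =1 f1 -> f' \o i2 =1 f2 -> f' =1 f].

Definition free_products (X : group_class) : group_class := fun G =>
  exists (G1 G2 : groupType)
         (i1 : {multiplicative G1 -> G}) (i2 : {multiplicative G2 -> G}),
    [/\ X G1, X G2 & is_free_product i1 i2].

(* Main.v *)
Require Import Defs.
From HB Require Import structures.
From mathcomp Require Import all_boot.
From mathcomp Require Import all_classical.
From mathcomp Require Import zify.

(** In a free product [F = G1 * G2], an element is conjugate either into a factor
    or to a cyclically reduced word [x] of even length. In the first case its
    centraliser lies in the same conjugate of the factor, and the factor being
    CSA applies. In the second case every nontrivial [y] commuting with [x] is
    again cyclically reduced of even length, because [|xy| = |yx|], so word
    length, signed by the factor of the first letter, embeds the centraliser of
    [x] into the integers; and if [x ^ g] commutes with [x], both have the same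
    translation length, so [x ^ g] is [x] or [x^-1]. The inverse is excluded
    since nonabelian CSA groups, hence [F], have no involutions. So centralisers
    in [F] are abelian and [x ^ g] commutes with [x <> 1] only if [g] does; for
    classes of such groups the equivalence follows by replacing a finite set of
    nontrivial elements with one iterated nontrivial commutator.

    The normal form in [F] comes from the universal property alone: [F] maps to
    the group of pairs (element of [F], permutation of the reduced words lifting
    its left multiplication), and the first projection retracts this map. *)

Set Implicit Arguments.
Unset Strict Implicit.
Unset Printing Implicit Defensive.

Local Open Scope classical_set_scope.
Local Open Scope group_scope.

(** * Reduced words and the group of lifts *)

Section Words.
Variables (G : groupType) (A : bool -> set G).
Hypothesis A_sub : forall b, is_subgroup (A b).

Implicit Types (b : bool) (a g : G) (w u : seq (bool * G)).

Lemma A1 b : A b 1. Proof. by case: (A_sub b). Qed.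
Lemma AM b x y : A b x -> A b y -> A b (x * y).
Proof. by case: (A_sub b) => _ + _; apply. Qed.
Lemma AV b x : A b x -> A b x^-1.
Proof. by case: (A_sub b) => _ _; apply. Qed.

Definition letter (l : bool * G) := (l.2 != 1) && `[< A l.1 l.2 >].
Definition alternate (l m : bool * G) := l.1 != m.1.
Definition reduced w := all letter w && sorted alternate w.
Definition eval w : G := \prod_(l <- w) l.2.
Definition avoids b w := if w is l :: _ then b != l.1 else true.

Lemma reduced_cons b a w :
  reduced ((b, a) :: w) = [&& a != 1, `[< A b a >], avoids b w & reduced w].
Proof.
rewrite /reduced /= /letter /= -!andbA.
by case: w => [|l w] /=; do !bool_congr.
Qed.

Lemma eval_nil : eval [::] = 1. Proof. exact: big_nil. Qed.

Lemma eval_cons b a w : eval ((b, a) :: w) = a * eval w.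
Proof. exact: big_cons. Qed.

Lemma eval_cat u w : eval (u ++ w) = eval u * eval w.
Proof. exact: big_cat. Qed.

(** Van der Waerden's device: reduced words correspond to pairs of an element of [A b] and a reduced
    word avoiding [b], with 1 for a missing first letter, so [A b] can act by multiplying the first
    component. *)
Definition peel b w : G * seq (bool * G) :=
  if w is (c, a) :: w' then if c == b then (a, w') else (1, w) else (1, [::]).

Definition cons_letter b a w := if a == 1 then w else (b, a) :: w.

Definition act b a w := cons_letter b (a * (peel b w).1) (peel b w).2.

Lemma peel_reduced b w : reduced w ->
  [/\ A b (peel b w).1, avoids b (peel b w).2, reduced (peel b w).2
    & cons_letter b (peel b w).1 (peel b w).2 = w].
Proof.
case: w => [|[c a] w] /=.
  by rewrite /cons_letter eqxx; split => //; apply: A1.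
case: (eqVneq c b) => [->|ncb] red_w; last first.
  by rewrite /cons_letter eqxx /= eq_sym; split => //; apply: A1.
move: red_w; rewrite reduced_cons => /and4P[a1 /asboolP Aa av rw] /=.
by rewrite /cons_letter (negPf a1).
Qed.

Lemma reduced_cons_letter b a w :
  A b a -> avoids b w -> reduced w -> reduced (cons_letter b a w).
Proof.
move=> Aa av rw; rewrite /cons_letter; case: eqVneq => // a1.
by rewrite reduced_cons a1 av rw !andbT; apply/asboolP.
Qed.

Lemma peel_avoids b w : avoids b w -> peel b w = (1, w).
Proof. by case: w => //= -[c a] w /=; rewrite eq_sym => /negPf ->. Qed.

Lemma peel_cons_letter b a w : avoids b w -> peel b (cons_letter b a w) = (a, w).
Proof.
rewrite /cons_letter; case: eqVneq => [-> /peel_avoids //|_ _ /=].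
by rewrite eqxx.
Qed.

Lemma act_avoids b a w : a != 1 -> avoids b w -> act b a w = (b, a) :: w.
Proof.
by move=> a1 av; rewrite /act peel_avoids //= mulg1 /cons_letter (negPf a1).
Qed.

Lemma act_reduced b a w : A b a -> reduced w -> reduced (act b a w).
Proof.
move=> Aa rw; have [Ap av rp _] := peel_reduced b rw.
by apply: reduced_cons_letter => //; apply: AM.
Qed.

Lemma act1 b w : reduced w -> act b 1 w = w.
Proof. by move=> rw; rewrite /act mul1g; have [_ _ _] := peel_reduced b rw. Qed.

Lemma actM b a a' w : reduced w -> act b (a * a') w = act b a (act b a' w).
Proof.
move=> rw; have [_ av _ _] := peel_reduced b rw.
by rewrite {2 3}/act peel_cons_letter //= mulgA.
Qed.

Lemma size_act b a w : size (act b a w) <= (size w).+1.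
Proof.
have cl c v : size (cons_letter b c v) <= (size v).+1.
  by rewrite /cons_letter; case: ifP => // _; apply: ltnW.
apply: leq_trans (cl _ _) _; rewrite ltnS.
by case: w => [|[c d] w] //=; case: ifP => _ //=; apply: ltnW.
Qed.

Lemma eval_cons_letter b a w : eval (cons_letter b a w) = a * eval w.
Proof.
rewrite /cons_letter; case: eqVneq => [->|_]; first by rewrite mul1g.
by rewrite eval_cons.
Qed.

Lemma eval_act b a w : eval (act b a w) = a * eval w.
Proof.
rewrite /act eval_cons_letter -mulgA; congr (_ * _).
case: w => [|[c d] w] /=; first by rewrite mul1g.
by case: ifP => _ /=; rewrite ?mul1g ?eval_cons.
Qed.

Definition rword := {w | reduced w}.

(* A pair of an element [g] of [G] and a permutation of the reduced words that
   lifts left multiplication by [g] along [eval]. *)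
Record lift := Lift {
  lift_base : G;
  lift_fun : rword -> rword;
  lift_inv : rword -> rword;
  lift_funK : cancel lift_fun lift_inv;
  lift_invK : cancel lift_inv lift_fun;
  lift_eval : forall w : rword, eval (val (lift_fun w)) = lift_base * eval (val w)
}.

(** The inverse is determined by the function, and the other fields are proofs. *)
Lemma lift_eq (s t : lift) :
  lift_base s = lift_base t -> lift_fun s =1 lift_fun t -> s = t.
Proof.
case: s t => [g f f' fK f'K fe] [h k k' kK k'K ke] /= gh /funext fk.
subst h k; have f'k' : f' = k'.
  by apply/funext => w; rewrite -[RHS]fK k'K.
subst k'; congr Lift; exact: Prop_irrelevance.
Qed.

HB.instance Definition _ := gen_eqMixin lift.
HB.instance Definition _ := gen_choiceMixin lift.

Program Definition lift_one := @Lift 1 id id _ _ _.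
Next Obligation. by []. Qed.
Next Obligation. by []. Qed.
Next Obligation. by move=> w; rewrite mul1g. Qed.

Program Definition lift_mul (s t : lift) :=
  @Lift (lift_base s * lift_base t) (lift_fun s \o lift_fun t)
    (lift_inv t \o lift_inv s) _ _ _.
Next Obligation. move=> s t; exact: can_comp (@lift_funK s) (@lift_funK t). Qed.
Next Obligation. move=> s t; exact: can_comp (@lift_invK t) (@lift_invK s). Qed.
Next Obligation. by move=> s t w; rewrite !lift_eval mulgA. Qed.

Program Definition lift_opp (s : lift) :=
  @Lift (lift_base s)^-1 (lift_inv s) (lift_fun s) _ _ _.
Next Obligation. exact: lift_invK. Qed.
Next Obligation. exact: lift_funK. Qed.
Next Obligation.
by move=> s w; rewrite -{2}[w](lift_invK s) lift_eval mulKg.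
Qed.

Fact lift_mulA : associative lift_mul.
Proof. by move=> s t u; apply: lift_eq => //=; rewrite mulgA. Qed.
Fact lift_mul1 : left_id lift_one lift_mul.
Proof. by move=> s; apply: lift_eq => //=; rewrite mul1g. Qed.
Fact lift_mulr1 : right_id lift_one lift_mul.
Proof. by move=> s; apply: lift_eq => //=; rewrite mulg1. Qed.
Fact lift_mulV : left_inverse lift_one lift_opp lift_mul.
Proof.
by move=> s; apply: lift_eq => [|w] /=; rewrite ?mulVg ?lift_funK.
Qed.
Fact lift_mulrV : right_inverse lift_one lift_opp lift_mul.
Proof.
by move=> s; apply: lift_eq => [|w] /=; rewrite ?mulgV ?lift_invK.
Qed.

HB.instance Definition _ :=
  isGroup.Build lift lift_mulA lift_mul1 lift_mulr1 lift_mulV lift_mulrV.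

HB.instance Definition _ :=
  isMultiplicative.Build lift G lift_base (fun _ _ => erefl).

Definition ract b a (Aa : A b a) (w : rword) : rword :=
  exist _ (act b a (val w)) (act_reduced Aa (valP w)).

Program Definition lift_act b a (Aa : A b a) : lift :=
  @Lift a (ract Aa) (ract (AV Aa)) _ _ _.
Next Obligation.
by move=> b a Aa w; apply: val_inj => /=; rewrite -actM ?mulVg ?act1 ?(valP w).
Qed.
Next Obligation.
by move=> b a Aa w; apply: val_inj => /=; rewrite -actM ?mulgV ?act1 ?(valP w).
Qed.
Next Obligation. by move=> b a Aa w; rewrite /= eval_act. Qed.

(** The last clause, equivariance under each factor, is what makes reduced words unique: with [nf 1]
    it gives [nf_eval] by induction. *)
Definition normal_form (nf : G -> seq (bool * G)) :=
  [/\ nf 1 = [::], (forall g, reduced (nf g)), (forall g, eval (nf g) = g)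
    & forall b a g, A b a -> nf (a * g) = act b a (nf g)].

End Words.

(** * Normal forms and word length *)

Section Lengths.
Variables (G : groupType) (A : bool -> set G).
Hypothesis A_sub : forall b, is_subgroup (A b).
Variable nf : G -> seq (bool * G).
Hypothesis nfP : normal_form A nf.

Implicit Types (b c : bool) (g h x y z : G) (w u : seq (bool * G)).

Definition len g := size (nf g).
(** At [g = 1] the default letter gives the arbitrary value [true]; hence the nontriviality
    assumptions in the lemmas on the ends of words. *)
Definition first g := (head (true, 1) (nf g)).1.
Definition final g := (last (true, 1) (nf g)).1.

Lemma nf1 : nf 1 = [::]. Proof. by case: nfP. Qed.
Lemma nf_reduced g : reduced A (nf g). Proof. by case: nfP. Qed.
Lemma nfK g : eval (nf g) = g. Proof. by case: nfP. Qed.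
Lemma nf_act b a g : A b a -> nf (a * g) = act b a (nf g).
Proof. by case: nfP => _ _ _ nfA; apply: nfA. Qed.

Lemma nf_eval w : reduced A w -> nf (eval w) = w.
Proof.
elim: w => [|[b a] w IHw]; first by rewrite eval_nil nf1.
rewrite reduced_cons => /and4P[a1 /asboolP Aa av rw].
by rewrite eval_cons (nf_act _ Aa) IHw // act_avoids.
Qed.

Lemma len_eq0 g : (len g == 0%N) = (g == 1).
Proof.
apply/idP/eqP => [/eqP/size0nil g0|->]; last by rewrite /len nf1.
by rewrite -(nfK g) g0 eval_nil.
Qed.

Lemma nf_neq1 g : g != 1 -> exists b a w, nf g = (b, a) :: w.
Proof.
by rewrite -len_eq0 /len; case: (nf g) => [|[b a] w] // _; exists b, a, w.
Qed.

(** Trivial letters and neighbours from the same factor are allowed, so this bounds lengths after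
    merging: acting by a letter adds at most one. *)
Lemma len_eval w : all (fun l => `[< A l.1 l.2 >]) w -> len (eval w) <= size w.
Proof.
elim: w => [|[b a] w IHw] /=; first by rewrite eval_nil /len nf1.
case/andP=> /asboolP Aa /IHw le_w; rewrite eval_cons /len (nf_act _ Aa).
by apply: leq_trans (size_act _ _ _) _; rewrite ltnS.
Qed.

Lemma all_letter w : reduced A w -> all (fun l => `[< A l.1 l.2 >]) w.
Proof. by case/andP=> + _; apply: sub_all => l /andP[]. Qed.

Lemma len_mul x y : len (x * y) <= len x + len y.
Proof.
rewrite -{1}(nfK x) -{1}(nfK y) -eval_cat /len -size_cat.
by apply: len_eval; rewrite all_cat !all_letter ?nf_reduced.
Qed.

Lemma nfV g : nf g^-1 = rev [seq (l.1, l.2^-1) | l <- nf g].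
Proof.
have evV w : eval (rev [seq (l.1, l.2^-1) | l <- w]) = (eval w)^-1.
  elim: w => [|[b a] w IHw] /=; first by rewrite /rev /= eval_nil invg1.
  by rewrite rev_cons -cats1 eval_cat IHw !eval_cons eval_nil mulg1 invgM.
rewrite -{1}(nfK g) -evV nf_eval // /reduced all_rev all_map rev_sorted.
case/andP: (nf_reduced g) => lg sg; apply/andP; split.
  apply: sub_all lg => -[b a] /andP[] /= a1 /asboolP Aa.
  by rewrite /letter /= invg_eq1 a1 /=; apply/asboolP; apply: AV.
rewrite sorted_map; apply: sub_sorted sg => -[b a] [c d].
by rewrite /alternate /= eq_sym.
Qed.

Lemma lenV g : len g^-1 = len g.
Proof. by rewrite /len nfV size_rev size_map. Qed.

Lemma firstV g : g != 1 -> first g^-1 = final g.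
Proof.
case/nf_neq1 => b [a [w nfg]]; rewrite /first /final nfV nfg.
by rewrite lastI map_rcons rev_rcons last_rcons.
Qed.

Lemma finalV g : g != 1 -> final g^-1 = first g.
Proof. by move=> g1; rewrite -firstV ?invgK ?invg_eq1. Qed.

Lemma nf_mul x y : x != 1 -> y != 1 -> final x != first y ->
  nf (x * y) = nf x ++ nf y.
Proof.
move=> x1 y1 xy; rewrite -{1}(nfK x) -{1}(nfK y) -eval_cat nf_eval //.
move: xy; rewrite /final /first.
move: (nf_reduced x) (nf_reduced y).
have [b [a [w ->]]] := nf_neq1 x1; have [c [d [u ->]]] := nf_neq1 y1.
case/andP=> lx sx /andP[ly sy] xy; rewrite /reduced all_cat lx ly /=.
by rewrite cat_path; apply/and3P.
Qed.

Lemma len_mulE x y : x != 1 -> y != 1 -> final x != first y ->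
  len (x * y) = (len x + len y)%N.
Proof. by move=> *; rewrite /len nf_mul // size_cat. Qed.

Lemma first_mul x y : x != 1 -> y != 1 -> final x != first y ->
  first (x * y) = first x.
Proof.
move=> x1 y1 xy; rewrite /first nf_mul //.
by have [b [a [w ->]]] := nf_neq1 x1.
Qed.

Lemma final_mul x y : x != 1 -> y != 1 -> final x != first y ->
  final (x * y) = final y.
Proof.
move=> x1 y1 xy; rewrite /final nf_mul //.
by have [b [a [w ->]]] := nf_neq1 y1; rewrite last_cat.
Qed.

Lemma mul_neq1 x y : x != 1 -> y != 1 -> final x != first y -> x * y != 1.
Proof.
move=> x1 y1 xy; rewrite -len_eq0 len_mulE // addn_eq0 negb_and.
by rewrite len_eq0 x1.
Qed.

(** The last letter of [x] and the first letter of [y] merge into one, possibly trivial, letter. *)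
Lemma len_mul_lt x y : x != 1 -> y != 1 -> final x = first y ->
  len (x * y) < len x + len y.
Proof.
move=> x1 y1; move: (nf_reduced x) (nf_reduced y); rewrite /final /first.
rewrite -{3}(nfK x) -{3}(nfK y) /len.
have [b [a [w ->]]] := nf_neq1 x1; have [c [d [u ->]]] := nf_neq1 y1.
rewrite (lastI _ w); move: (belast _ w) (last _ w) => {b a}w [b a].
rewrite last_rcons /= => /all_letter lx /all_letter ly bc; subst c.
have {lx}[Aa lw] : A b a /\ all (fun l => `[< A l.1 l.2 >]) w.
  by move: lx; rewrite all_rcons => /andP[/asboolP].
have {ly}[Ad lu] : A b d /\ all (fun l => `[< A l.1 l.2 >]) u.
  by move: ly => /= /andP[/asboolP].
have -> : eval (rcons w (b, a)) * eval ((b, d) :: u)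
        = eval (w ++ (b, a * d) :: u).
  by rewrite -cats1 !eval_cat !eval_cons eval_nil mulg1 !mulgA.
apply: leq_ltn_trans (len_eval _) _.
  by rewrite all_cat lw /= lu andbT; apply/asboolP; apply: AM.
by rewrite size_cat size_rcons /= ltnS.
Qed.

(* The elements whose axis in the Bass-Serre tree passes through the base edge,
   oriented by [b]. *)
Definition cyc_reduced b g := [/\ g != 1, first g = b & final g = ~~ b].

Lemma cyc_reducedV b g : cyc_reduced b g -> cyc_reduced (~~ b) g^-1.
Proof.
by case=> g1 fg lg; split; rewrite ?invg_eq1 ?firstV ?finalV ?fg ?negbK.
Qed.

Lemma cyc_reducedM b x y : cyc_reduced b x -> cyc_reduced b y ->
  cyc_reduced b (x * y) /\ len (x * y) = (len x + len y)%N.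
Proof.
move=> [x1 fx lx] [y1 fy ly].
have xy : final x != first y by rewrite lx fy; case: b {fx lx fy ly}.
by rewrite len_mulE //; split=> //; split; rewrite ?mul_neq1 ?first_mul ?final_mul.
Qed.

Lemma cyc_reducedX b x n : cyc_reduced b x -> len (x ^+ n) = (n * len x)%N.
Proof.
move=> crx; case: n => [|n]; first by rewrite mul0n; apply/eqP; rewrite len_eq0.
suff [] : cyc_reduced b (x ^+ n.+1) /\ len (x ^+ n.+1) = (n.+1 * len x)%N by [].
elim: n => [|n [cry ly]]; first by rewrite mul1n.
by rewrite expgS mulSn -ly; apply: cyc_reducedM.
Qed.

Lemma len_pos g : g != 1 -> 0 < len g.
Proof. by rewrite lt0n len_eq0. Qed.

(** If [y] began and ended in the same factor, exactly one of [x * y] and [y * x] would be a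
    concatenation without merging, so their lengths would differ. *)
Lemma cyc_reduced_commute b x y : cyc_reduced b x -> commute x y -> y != 1 ->
  cyc_reduced b y \/ cyc_reduced (~~ b) y.
Proof.
move=> [x1 fx lx] xy y1.
have lenxy := congr1 len xy.
have lenL : first y = final y -> False.
  move=> fly; case: (eqVneq (first y) b) => fyb.
    have := len_mulE x1 y1; have := len_mul_lt y1 x1.
    rewrite fx lx -fly fyb; case: b {fx lx fyb} => /(_ erefl) + /(_ isT); lia.
  have := len_mulE y1 x1; have := len_mul_lt x1 y1.
  rewrite fx lx -fly; case: b (first y) fyb {fx lx} => -[] // _ /(_ erefl) + /(_ isT); lia.
rewrite /cyc_reduced; move: lenL.
case: b (first y) (final y) {fx lx} => -[] [] // H; by [left | right | case: H].
Qed.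

(** If [q = y * z^-1] were nontrivial, it would be cyclically reduced. Depending on its orientation,
    [q * z = y] is longer than [z], or [q^-1 * y = z] is longer than [y]. *)
Lemma cyc_reduced_len_inj b x y z : cyc_reduced b x ->
  commute x y -> commute x z -> cyc_reduced b y -> cyc_reduced b z ->
  len y = len z -> y = z.
Proof.
move=> crx xy xz cry crz lyz; apply/eqP/negP => /negP nyz.
have nq : y * z^-1 != 1 by rewrite mulg_eq1 invgK.
have xq : commute x (y * z^-1) by apply/commuteM/commuteV.
case: (cyc_reduced_commute crx xq nq) => crq.
  have [_] := cyc_reducedM crq crz; rewrite mulgVK lyz.
  by have := len_pos nq; lia.
have := cyc_reducedV crq; rewrite negbK => crq'.
have [_] := cyc_reducedM crq' cry.
by rewrite lenV invgM invgK mulgVK; have := len_pos nq; lia.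
Qed.

(** For [u], [v] oriented like [x], the products [u * v] and [v * u] have equal length, hence
    coincide. Inverting elements reduces to this case. *)
Lemma cyc_reduced_cent b x y z : cyc_reduced b x ->
  commute x y -> commute x z -> commute y z.
Proof.
move=> crx.
have crM (u v : G) : commute x u -> commute x v ->
    cyc_reduced b u -> cyc_reduced b v -> commute u v.
  move=> xu xv cru crv.
  have [uv luv] := cyc_reducedM cru crv; have [vu lvu] := cyc_reducedM crv cru.
  by apply: (cyc_reduced_len_inj crx) => //;
    rewrite ?luv ?lvu 1?addnC //; apply: commuteM.
have VK (u v : G) : commute u^-1 v -> commute u v.
  by move=> /commute_sym /commuteV; rewrite invgK => /commute_sym.
have pos (u : G) : commute x u -> u != 1 ->
    cyc_reduced b u \/ cyc_reduced b u^-1.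
  move=> xu u1; case: (cyc_reduced_commute crx xu u1) => [|/cyc_reducedV].
    by left.
  by rewrite negbK; right.
move=> xy xz.
have [->|y1] := eqVneq y 1; first exact/commute_sym/commute1.
have [->|z1] := eqVneq z 1; first exact/commute1.
have [xy' xz'] := (commuteV xy, commuteV xz).
case: (pos y xy y1) (pos z xz z1) => cry [] crz.
- exact: crM.
- by apply/commute_sym/VK/crM.
- exact/VK/crM.
- exact/VK/commute_sym/VK/crM.
Qed.

(** Powers of both elements have linearly growing length, while conjugating by [g] adds at most
    [2 * len g], whatever the exponent. *)
Lemma cyc_reduced_lenJ b c x g : cyc_reduced b x -> cyc_reduced c (x ^ g) ->
  len (x ^ g) <= len x.
Proof.
(* Any exponent above [2 * len g] works: one extra letter in [x ^ g] would cost [n] letters in its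
   power. *)
move=> crx cry; set n := (2 * len g).+1%N.
have: len ((x ^ g) ^+ n) <= (n * len x + 2 * len g)%N.
  rewrite -conjXg conjgE -(cyc_reducedX n crx).
  apply: leq_trans (len_mul _ _) _; rewrite lenV.
  by apply: leq_trans (leq_add (leqnn _) (len_mul _ _)) _; lia.
by rewrite (cyc_reducedX _ cry) /n; nia.
Qed.

(** * Conjugation into a factor or to a cyclically reduced element *)

Lemma nf_factor b a : A b a -> a != 1 -> nf a = [:: (b, a)].
Proof.
move=> Aa a1; have {1}-> : a = eval [:: (b, a)].
  by rewrite eval_cons eval_nil mulg1.
by rewrite nf_eval // reduced_cons a1 /= andbT; apply/asboolP.
Qed.

Lemma len_factor b a : A b a -> len a <= 1.
Proof.
move=> Aa; have [->|a1] := eqVneq a 1; first by rewrite /len nf1.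
by rewrite /len (nf_factor Aa).
Qed.

(** Write [h = a * v] with [a] in the factor and [v] avoiding it. If [v] is nontrivial, then
    [v^-1 * x ^ a * v] involves no merging and has length at least 3, too long for a factor. *)
Lemma factor_malnormal b x h : A b x -> x != 1 -> A b (x ^ h) -> A b h.
Proof.
move=> Ax x1 Axh; have := peel_reduced A_sub b (nf_reduced h).
case: (peel b (nf h)) => a w /= [Aa av rw defh].
have {defh} defh : h = a * eval w by rewrite -(eval_cons_letter b) defh nfK.
have [w0|w1] := eqVneq (eval w) 1; first by rewrite defh w0 mulg1.
have Ay : A b (x ^ a) by apply: AM => //; [apply: AV | apply: AM].
have y1 : x ^ a != 1 by rewrite conjg_eq1.
have yw : final (x ^ a) != first (eval w).
  rewrite /final /first (nf_factor Ay y1) nf_eval //.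
  by move: av w1; case: (w) => //=; rewrite eval_nil eqxx.
have fy : final (x ^ a) = first (x ^ a).
  by rewrite /final /first (nf_factor Ay y1).
move: Axh; rewrite defh conjgM => /len_factor.
move: (x ^ a) (eval w) y1 w1 yw fy => y v y1 v1 yv fy; rewrite conjgE.
have vy : final v^-1 != first y by rewrite finalV // -fy eq_sym.
rewrite len_mulE ?invg_eq1 ?mul_neq1 ?first_mul // len_mulE // lenV.
by have := len_pos y1; have := len_pos v1; lia.
Qed.

(** Induction on length: when both ends lie in the same factor, conjugating by the first letter
    moves it to the end, where it merges. *)
Lemma conj_factor_or_cyc x : x != 1 ->
  exists g b, A b (x ^ g) \/ cyc_reduced b (x ^ g).
Proof.
have [n] := ubnP (len x); elim: n x => // n IHn x; rewrite ltnS => lxn x1.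
have [b [a [w nfx]]] := nf_neq1 x1.
have [fl|fl] := eqVneq (final x) (~~ first x).
  by exists 1, (first x); right; rewrite conjg1.
have := nf_reduced x; rewrite nfx reduced_cons.
case/and4P=> a1 /asboolP Aa _ rw.
have defx : x = a * eval w by rewrite -(nfK x) nfx eval_cons.
have [w0|w1] := eqVneq (eval w) 1.
  by exists 1, b; left; rewrite conjg1 defx w0 mulg1.
have xa : x ^ a = eval w * a by rewrite conjgE {1}defx -mulgA mulKg.
have [] := IHn (x ^ a); rewrite ?conjg_eq1 //; last first.
  by move=> g [c Hg]; exists (a * g), c; rewrite conjgM.
apply: leq_trans lxn; rewrite xa.
have -> : len x = (len (eval w) + len a)%N.
  by rewrite addnC /len nfx (nf_factor Aa a1) nf_eval.
apply: len_mul_lt => //; rewrite /first (nf_factor Aa a1) /=.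
move: fl w1; rewrite /final /first nfx nf_eval //.
case: (w) => [|l u] /=; first by rewrite eval_nil eqxx.
by case: b {nfx Aa} (last l u) => -[[]].
Qed.

(** * Centralisers and conjugation in the free product *)

Hypothesis A_cent : forall b x y z, A b x -> A b y -> A b z -> x != 1 ->
  commute x y -> commute x z -> commute y z.
Hypothesis A_conj : forall b x g, A b x -> A b g -> x != 1 ->
  commute x (x ^ g) -> commute x g.
Hypothesis A_inv : forall b x, A b x -> x * x = 1 -> x = 1.

(** Squaring doubles the length of a cyclically reduced element, so an involution would be conjugate
    into a factor. *)
Lemma no_involution x : x * x = 1 -> x = 1.
Proof.
move=> xx; apply/eqP/negP => /negP x1.
have [g [b]] := conj_factor_or_cyc x1.
have yy : x ^ g * x ^ g = 1 by rewrite -conjMg xx conj1g.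
have y1 : x ^ g != 1 by rewrite conjg_eq1.
case=> [Ay|cry]; first by rewrite (A_inv Ay yy) eqxx in y1.
have [_] := cyc_reducedM cry cry.
by rewrite yy {1}/len nf1 /=; have := len_pos y1; lia.
Qed.

(* Two conjugate commuting elements have the same translation length, so
   [x ^ g] is [x] or [x^-1]; in the latter case [g * g] centralises [x]. *)
Lemma cyc_reduced_conj b x g :
  cyc_reduced b x -> commute x (x ^ g) -> commute x g.
Proof.
move=> crx xy; have [x1 _ _] := crx.
have y1 : x ^ g != 1 by rewrite conjg_eq1.
have lyx c : cyc_reduced c (x ^ g) -> len (x ^ g) = len x.
  move=> cry; apply/eqP; rewrite eqn_leq (cyc_reduced_lenJ crx cry) /=.
  by have := @cyc_reduced_lenJ c b (x ^ g) g^-1 cry; rewrite conjgK; apply.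
case: (cyc_reduced_commute crx xy y1) => cry.
  apply/commgP; rewrite -conjg_fix; apply/eqP.
  by apply: (cyc_reduced_len_inj crx); rewrite ?(lyx b).
have := cyc_reducedV cry; rewrite negbK => cry'.
have {lyx} xV : x = (x ^ g)^-1.
  apply: (cyc_reduced_len_inj crx) => //; first exact: commuteV.
  by rewrite lenV (lyx _ cry).
have xg : x ^ g = x^-1 by rewrite {2}xV invgK.
have xgg : commute x (g * g).
  apply/commgP; rewrite -conjg_fix conjgM; apply/eqP.
  by rewrite xg conjVg xg invgK.
(* Otherwise [g = 1], so [x = x^-1] and [x] is an involution. *)
have gg1 : g * g != 1.
  apply/eqP => /no_involution g1; move: xg; rewrite g1 conjg1 => xg.
  by move: x1; rewrite (no_involution (x := x)) ?eqxx // {1}xg mulVg.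
(* Both [x] and [g] centralise [g * g], which is cyclically reduced because it commutes with [x]. *)
have [c crgg] : exists c, cyc_reduced c (g * g).
  by case: (cyc_reduced_commute crx xgg gg1); eexists; eauto.
by apply: (cyc_reduced_cent crgg); [apply: commute_sym | apply/commute_sym/commuteM].
Qed.

Lemma commuteJ x y g : commute x y <-> commute (x ^ g) (y ^ g).
Proof.
by rewrite /commute -!conjMg; split=> [->//|/conjg_inj].
Qed.

Lemma commute_conj x y : commute x y -> x ^ y = x.
Proof. by move/commgP/conjg_fixP. Qed.

(** When [x] is conjugate into a factor, [x ^ y = x] and [x ^ z = x] put [y] and [z] in the same
    conjugate by malnormality. *)
Lemma free_product_cent x y z : x != 1 ->
  commute x y -> commute x z -> commute y z.
Proof.
move=> x1; have [g [b xg]] := conj_factor_or_cyc x1.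
move=> /(commuteJ _ _ g) xy /(commuteJ _ _ g) xz; apply/(commuteJ _ _ g).
case: xg => [Ax|crx]; last exact: (cyc_reduced_cent crx).
have xg1 : x ^ g != 1 by rewrite conjg_eq1.
apply: (A_cent Ax) => //; apply: (factor_malnormal Ax) => //.
  by rewrite (commute_conj xy).
by rewrite (commute_conj xz).
Qed.

(** In the factor case malnormality is applied twice: [x ^ h] lies in the factor because it
    centralises [x], and then so does [h]. *)
Lemma free_product_conj x h : x != 1 -> commute x (x ^ h) -> commute x h.
Proof.
move=> x1; have [g [b xg]] := conj_factor_or_cyc x1.
move=> /(commuteJ _ _ g); rewrite conjJg => xy; apply/(commuteJ _ _ g).
case: xg => [Ax|crx]; last exact: (cyc_reduced_conj crx).
have xg1 : x ^ g != 1 by rewrite conjg_eq1.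
apply: (A_conj Ax) => //; apply: (factor_malnormal Ax) => //.
by apply: (factor_malnormal Ax) => //; rewrite (commute_conj xy).
Qed.

End Lengths.

(** * Group homomorphisms *)

Section Morphisms.
Variables (G H : groupType) (f : {multiplicative G -> H}).

Lemma mult1 : f 1 = 1.
Proof. by apply: (mulgI (f 1)); rewrite -gmulfM !mulg1. Qed.

Lemma multV x : f x^-1 = (f x)^-1.
Proof. by apply: (mulgI (f x)); rewrite -gmulfM !mulgV mult1. Qed.

Lemma multJ x y : f (x ^ y) = f x ^ f y.
Proof. by rewrite !conjgE !gmulfM multV. Qed.

Lemma multR x y : f [~ x, y] = [~ f x, f y].
Proof. by rewrite !commgEl gmulfM multV multJ. Qed.

Lemma range_subgroup : is_subgroup (range f).
Proof.
split; first by exists 1; rewrite ?mult1.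
  by move=> _ _ [x _ <-] [y _ <-]; exists (x * y); rewrite ?gmulfM.
by move=> _ [x _ <-]; exists x^-1; rewrite ?multV.
Qed.

End Morphisms.

Lemma multiplicative_of (G H : groupType) (f : G -> H) :
  {morph f : x y / x * y} -> exists F : {multiplicative G -> H}, F =1 f.
Proof.
move=> fM; pose m := isMultiplicative.Build G H f fM.
by exists (HB.pack_for {multiplicative G -> H} f m).
Qed.

(** * Normal form from the universal property *)

Section FreeProduct.
Variables (G1 G2 G : groupType).
Variables (i1 : {multiplicative G1 -> G}) (i2 : {multiplicative G2 -> G}).
Hypothesis i12 : is_free_product i1 i2.

(** The universal property gives a retraction: identity on [G1], trivial on [G2]. *)
Lemma free_product_inl_inj : injective i1.
Proof.
have [f [fi _ _]] := i12 (idfun : {multiplicative G1 -> G1})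
  (@one_fun G2 G1 : {multiplicative G2 -> G1}).
by apply: (@can_inj _ _ _ f) => a; apply: fi.
Qed.

Lemma free_product_inr_inj : injective i2.
Proof.
have [f [_ fi _]] := i12 (@one_fun G1 G2 : {multiplicative G1 -> G2})
  (idfun : {multiplicative G2 -> G2}).
by apply: (@can_inj _ _ _ f) => a; apply: fi.
Qed.

Definition factor (b : bool) : set G := if b then range i1 else range i2.

Lemma factor_subgroup b : is_subgroup (factor b).
Proof. by case: b; apply: range_subgroup. Qed.

Lemma free_product_normal_form : exists nf, normal_form factor nf.
Proof.
have A1i a : factor true (i1 a) by exists a.
have A2i a : factor false (i2 a) by exists a.
pose L b a (Aa : factor b a) := lift_act factor_subgroup Aa.
have LM b a a' (Aa : factor b a) (Aa' : factor b a') a'' (Aa'' : factor b a'') :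
    a'' = a * a' -> L b a'' Aa'' = L b a Aa * L b a' Aa'.
  move=> def; apply: lift_eq => [//|w]; apply: val_inj => /=.
  by rewrite def (actM factor_subgroup) ?(valP w).
have [F1 F1E] : exists F : {multiplicative G1 -> lift factor},
    F =1 fun a => L true _ (A1i a).
  by apply: multiplicative_of => a a'; apply: LM; rewrite gmulfM.
have [F2 F2E] : exists F : {multiplicative G2 -> lift factor},
    F =1 fun a => L false _ (A2i a).
  by apply: multiplicative_of => a a'; apply: LM; rewrite gmulfM.
have [f [f1 f2 _]] := i12 F1 F2.
(* The composite and the identity both extend [i1] and [i2], so uniqueness identifies them. *)
have fK g : lift_base (f g) = g.
  have [h [_ _ uniq_h]] := i12 i1 i2.
  transitivity (h g).
    apply: (uniq_h (@lift_base _ _ \o f : {multiplicative G -> G})) => a /=.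
      by rewrite [f _]f1 F1E.
    by rewrite [f _]f2 F2E.
  by symmetry; apply: (uniq_h (idfun : {multiplicative G -> G})).
have fA b a (Aa : factor b a) : f a = L b a Aa.
  apply: lift_eq => [|w]; first exact: fK.
  by case: b Aa => Aa; have [x _ defa] := Aa; move: Aa; rewrite -defa => Aa;
    rewrite ?[f _]f1 ?[f _]f2 ?F1E ?F2E; apply: val_inj.
have red0 : reduced factor [::] by [].
(* The normal form of [g] is the image of the empty word under [f g]. *)
exists (fun g => val (lift_fun (f g) (exist _ [::] red0))); split.
- by rewrite mult1.
- by move=> g; apply: valP.
- by move=> g; rewrite lift_eval fK /= eval_nil mulg1.
- by move=> b a g Aa; rewrite gmulfM (fA b a Aa).
Qed.

End FreeProduct.

Definition abelian_centralisers (G : groupType) :=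
  forall x y z : G, x != 1 -> commute x y -> commute x z -> commute y z.

(** An elementwise trace of malnormality: in a CSA group, a maximal abelian subgroup containing [x]
    and [x ^ g] contains [g]. *)
Definition conjugation_separated (G : groupType) :=
  forall x g : G, x != 1 -> commute x (x ^ g) -> commute x g.

(** * CSA groups *)

Section CSAGroups.
Variable G : groupType.
Implicit Types x y z g : G.

Lemma maximal_abelian_ex x y : commute x y ->
  exists M : set G, [/\ is_maximal_abelian M, M x & M y].
Proof.
(* The pair is adjoined inside [P] because Zorn's lemma also ranges over the empty chain, whose
   union contains neither [x] nor [y]. *)
move=> xy; pose P (B : set G) := abelian_set ([set x; y] `|` B).
have Pab (u v : G) : [set x; y] u -> [set x; y] v -> commute u v.
  by move=> [] -> [] -> //; apply: commute_sym.
have [F FP Ftot|M [PM maxM]] := @Zorn_bigcup _ P.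
  move=> u v [xyu|[B FB Bu]] [xyv|[C FC Cv]]; first exact: Pab.
  - by apply: (FP C FC); [left | right].
  - by apply: (FP B FB); [right | left].
  - by case: (Ftot _ _ FB FC) => [/(_ _ Bu) Cu|/(_ _ Cv) Bv];
      [apply: (FP C FC) | apply: (FP B FB)]; right.
(* By maximality [M] contains whatever commutes with [x], [y] and [M]; containing the pair, closure
   and maximality among abelian subgroups all follow. *)
have inM g : (forall u, ([set x; y] `|` M) u -> commute g u) -> M g.
  move=> cg; apply: contrapT => nMg; apply: (maxM (g |` M)).
    by split; [move=> u Mu; right | move=> /(_ g) H; apply/nMg/H; left].
  move=> u v Hu Hv.
  have cases w : ([set x; y] `|` (g |` M)) w -> w = g \/ ([set x; y] `|` M) w.
    by case=> [xyw|[->|Mw]]; [right; left | left | right; right].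
  case: (cases _ Hu) (cases _ Hv) => [->|Mu] [->|Mv] //; try exact: cg.
  - exact/commute_sym/cg.
  - exact: PM.
have xyM : [set x; y] `<=` M by move=> u xyu; apply: inM => v Mv; apply: PM; [left|].
have MxyE u : ([set x; y] `|` M) u -> M u by case => // /xyM.
have abM : abelian_set M by move=> u v Mu Mv; apply: PM; right.
exists M; split; [split | by apply: xyM; left | by apply: xyM; right].
  split=> //; split=> [|u v Mu Mv|u Mu]; apply: inM => w /MxyE Mw.
  - exact/commute_sym/commute1.
  - by apply/commute_sym/commuteM; apply: abM.
  - exact/commute_sym/commuteV/abM.
move=> N [_ abN] MN; apply/seteqP; split=> // g Ng.
by apply: inM => u /MxyE /MN Nu; apply: abN.
Qed.

Hypothesis csaG : CSA G.

Lemma maximal_abelian_conj (M : set G) x g :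
  is_maximal_abelian M -> M x -> M (x ^ g) -> x != 1 -> M g.
Proof.
move=> maxM Mx Mxg x1; apply: (csaG maxM) => E.
have : ([set m ^ g | m in M] `&` M) (x ^ g) by split=> //; exists x.
by rewrite E => /= /eqP; rewrite conjg_eq1 (negPf x1).
Qed.

Lemma CSA_abelian_centralisers : abelian_centralisers G.
Proof.
move=> x y z x1 xy xz; have [M [maxM Mx My]] := maximal_abelian_ex xy.
have Mz : M z.
  by apply: (maximal_abelian_conj maxM Mx) => //; rewrite (commute_conj xz).
by case: maxM => -[_ abM] _; apply: abM.
Qed.

Lemma CSA_conjugation_separated : conjugation_separated G.
Proof.
move=> x g x1 xxg; have [M [maxM Mx Mxg]] := maximal_abelian_ex xxg.
have Mg := maximal_abelian_conj maxM Mx Mxg x1.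
by case: maxM => -[_ abM] _; apply: abM.
Qed.

(* If [x] is an involution then it inverts [x * x ^ g], so that [x] commutes
   with every [x ^ g], hence with every [g]. *)
Lemma nonabelian_CSA_no_involution x : nonabelian G -> x * x = 1 -> x = 1.
Proof.
move=> nabG xx; apply/eqP/negP => /negP x1.
have xV : x^-1 = x by apply: mulg1_eq.
suff cx g : commute x g.
  by apply: nabG => u v _ _; apply: (CSA_abelian_centralisers x1).
apply: CSA_conjugation_separated => //.
have xgV : (x ^ g)^-1 = x ^ g by rewrite -conjVg xV.
have [t1|t1] := eqVneq (x * x ^ g) 1.
  by rewrite -(mulg1_eq t1); apply: commuteV.
have tV : (x * x ^ g) ^ x = (x * x ^ g)^-1.
  by move: (x ^ g) xgV => u uV; rewrite conjgE invgM uV xV !mulgA xx mul1g.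
have /commute_sym : commute (x * x ^ g) x.
  by apply: CSA_conjugation_separated => //; rewrite tV; apply: commuteV.
by move=> /(commuteM (commute_refl x)); rewrite mulgA xx mul1g.
Qed.

End CSAGroups.

(** * Residual properties and commutative transitivity *)

Section Baumslag.
Variable Y : group_class.
Hypothesis Y_cent : forall G, Y G -> abelian_centralisers G.
Hypothesis Y_conj : forall G, Y G -> conjugation_separated G.
Variable G : groupType.
Hypothesis nabG : nonabelian G.

Lemma fully_residually_residually : fully_residually Y G -> residually Y G.
Proof.
move=> fr g g1; have [|H [phi [YH Hphi]]] := fr [:: g].
  by move=> h; rewrite inE => /eqP ->.
by exists H, phi; split=> //; apply: Hphi; rewrite inE.
Qed.

(** A homomorphism keeping both [y] and [[~ x, z]] nontrivial contradicts the commutativity of the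
    centraliser of the image of [y]. *)
Lemma fully_residually_CT : fully_residually Y G -> commutative_transitive G.
Proof.
move=> fr x y z x1 y1 z1 xy yz; apply: contrapT => nxz.
have [|H [phi [YH Hphi]]] := fr [:: y; [~ x, z]].
  by move=> h; rewrite !inE => /orP[] /eqP ->.
have /eqP py1 := Hphi y (mem_head _ _).
apply: (Hphi [~ x, z]); first by rewrite !inE eqxx orbT.
rewrite multR; apply/eqP/commgP.
apply: (Y_cent YH py1); apply: gmulf_commute; last exact/commgP/eqP.
exact/commute_sym/commgP/eqP.
Qed.

Lemma CT_nonabelian_noncentral (x : G) : commutative_transitive G -> x <> 1 ->
  exists y, ~ commute x y.
Proof.
move=> ctG x1; apply: contrapT => /forallNP cx; apply: nabG => u v _ _.
have {}cx g : commute x g by apply: contrapT.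
have [->|/eqP u1] := eqVneq u 1; first exact/commute_sym/commute1.
have [->|/eqP v1] := eqVneq v 1; first exact/commute1.
apply/commgP/eqP; apply: (ctG u x v) => //; apply/eqP/commgP => //.
exact: commute_sym.
Qed.

(** Otherwise transitivity through [x] makes [y] commute with all its conjugates. Choose [t] not
    commuting with [y] and a homomorphism keeping [[~ y, t]] nontrivial: its target is not
    conjugation separated. *)
Lemma conj_noncommute (x y : G) : residually Y G ->
  commutative_transitive G -> x <> 1 -> y <> 1 -> exists t, ~ commute x (y ^ t).
Proof.
move=> resG ctG x1 y1; apply: contrapT => /forallNP cxy.
have {}cxy t : commute x (y ^ t) by apply: contrapT.
have [t nyt] := CT_nonabelian_noncentral ctG y1.
have yyt : commute y (y ^ t).
  apply/commgP/eqP; apply: (ctG y x (y ^ t)) => //.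
  - by move=> /eqP; rewrite conjg_eq1 => /eqP.
  - by apply/eqP/commgP; rewrite -(conjg1 y); apply: commute_sym.
  - exact/eqP/commgP.
have [|H [phi [YH]]] := resG [~ y, t]; first by move/eqP/commgP.
rewrite multR => /eqP nphi; case/negP: nphi; apply/commgP.
have [->|py1] := eqVneq (phi y) 1; first exact/commute_sym/commute1.
by apply: (Y_conj YH py1); rewrite -multJ; apply: gmulf_commute.
Qed.

(* A nontrivial commutator [~ x, y ^ t] survives only if both [x] and [y] do,
   so finitely many elements can be traded for a single one. *)
Lemma residually_CT_fully_residually : residually Y G ->
  commutative_transitive G -> fully_residually Y G.
Proof.
move=> resG ctG s s1.
suff [g [g1 gs]] : exists g : G, g <> 1 /\
    forall (H : groupType) (phi : {multiplicative G -> H}),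
      phi g <> 1 -> forall h, h \in s -> phi h <> 1.
  have [H [phi [YH pg1]]] := resG g g1.
  by exists H, phi; split=> //; apply: gs.
elim: s s1 => [|x s IHs] s1.
  (* For the empty list any nontrivial element will do. *)
  have /existsNP[g /eqP g1] : ~ forall g : G, g = 1.
    by move=> all1; apply: nabG => u v _ _; rewrite (all1 u) (all1 v).
  by exists g; split=> //; apply/eqP.
have [|y [y1 ys]] := IHs; first by move=> h hs; apply: s1; rewrite inE hs orbT.
have x1 : x <> 1 by apply: s1; rewrite mem_head.
have [t nxyt] := conj_noncommute resG ctG x1 y1.
exists [~ x, y ^ t]; split; first by move/eqP/commgP.
move=> H phi; rewrite multR multJ => pxy h; rewrite inE => /orP[/eqP -> px1|].
  by apply: pxy; rewrite px1 comm1g.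
by apply: ys => py1; apply: pxy; rewrite py1 conj1g commg1.
Qed.

End Baumslag.

(** * Free products of nonabelian CSA groups *)

(** The properties of the factors transfer along the injections [i1] and [i2]; nonabelianness enters
    by excluding involutions. *)
Lemma free_products_CSA (X : group_class)
    (hX : forall G : groupType, X G -> nonabelian G /\ CSA G) (G : groupType) :
  free_products X G -> abelian_centralisers G /\ conjugation_separated G.
Proof.
move=> [G1 [G2 [i1 [i2 [XG1 XG2 fp]]]]].
have [nf nfP] := free_product_normal_form fp.
have [nab1 csa1] := hX _ XG1; have [nab2 csa2] := hX _ XG2.
have i1_inj := free_product_inl_inj fp; have i2_inj := free_product_inr_inj fp.
have neq1 (K : groupType) (i : {multiplicative K -> G}) a : i a != 1 -> a != 1.
  by apply: contra => /eqP ->; rewrite mult1.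
have com (K : groupType) (i : {multiplicative K -> G}) a b : injective i ->
    commute (i a) (i b) -> commute a b.
  by move=> i_inj; rewrite /commute -!gmulfM => /i_inj.
have A_cent b x y z : factor i1 i2 b x -> factor i1 i2 b y ->
    factor i1 i2 b z -> x != 1 -> commute x y -> commute x z -> commute y z.
  case: b => -[a _ <-] [c _ <-] [d _ <-] /neq1 a1.
    move=> /(com _ _ _ _ i1_inj) ac /(com _ _ _ _ i1_inj) ad.
    exact/gmulf_commute/(CSA_abelian_centralisers csa1 a1).
  move=> /(com _ _ _ _ i2_inj) ac /(com _ _ _ _ i2_inj) ad.
  exact/gmulf_commute/(CSA_abelian_centralisers csa2 a1).
have A_conj b x g : factor i1 i2 b x -> factor i1 i2 b g -> x != 1 ->
    commute x (x ^ g) -> commute x g.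
  case: b => -[a _ <-] [c _ <-] /neq1 a1; rewrite -multJ.
    move=> /(com _ _ _ _ i1_inj) ac.
    exact/gmulf_commute/(CSA_conjugation_separated csa1).
  move=> /(com _ _ _ _ i2_inj) ac.
  exact/gmulf_commute/(CSA_conjugation_separated csa2).
have A_inv b x : factor i1 i2 b x -> x * x = 1 -> x = 1.
  case: b => -[a _ <-]; rewrite -gmulfM.
    rewrite -(mult1 i1) => /i1_inj aa.
    by rewrite (nonabelian_CSA_no_involution csa1 nab1 aa).
  rewrite -(mult1 i2) => /i2_inj aa.
  by rewrite (nonabelian_CSA_no_involution csa2 nab2 aa).
have fsub := factor_subgroup i1 i2.
split; first by move=> x y z; apply: (free_product_cent fsub nfP A_cent).
by move=> x g; apply: (free_product_conj fsub nfP A_conj A_inv).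
Qed.

Theorem corollary4p2 (X : group_class)
    (hX : forall G : groupType, X G -> nonabelian G /\ CSA G) :
  satisfies_B (free_products X).
Proof.
have Y_cent G : free_products X G -> abelian_centralisers G.
  by move=> /(free_products_CSA hX)[].
have Y_conj G : free_products X G -> conjugation_separated G.
  by move=> /(free_products_CSA hX)[].
move=> G nabG; split=> [fr|[resG ctG]].
  by split; [apply: fully_residually_residually | apply: (fully_residually_CT Y_cent)].
exact: (residually_CT_fully_residually Y_conj).
Qed.
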